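(* Let $p$ be an odd natural number. Define a double-indexed sequence $A_r(k)$ (integers $r\ge 0$, $k\ge 0$) by $A_r(0)=1$ for all $r$ and, for $k\ge 1$, $$A_r(k)=(p-r-k)\,A_r(k-1)+4\,(p-2r)\,A_{r+1}(k-1).$$ Then $$2^p-1=\frac{A_0(\lfloor p/2\rfloor)}{(p-1)(p-2)\cdots(p-\lfloor p/2\rfloor)}.$$
   Context: The denominator is $\prod_{j=1}^{\lfloor p/2\rfloor}(p-j)$; an empty product equals $1$. *)

(* Defs.v *)
From mathcomp Require Import all_boot all_order all_algebra.

Set Implicit Arguments.
Unset Strict Implicit.
Unset Printing Implicit Defensive.

Import GRing.Theory.
Local Open Scope ring_scope.

(* [A p r k] is A_r(k) for the parameter p. It takes integer values: the
   factors p - r - k and p - 2r may be negative. *)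
Fixpoint A (p r k : nat) : int :=
  match k with
  | 0%N => 1
  | k'.+1 => (p%:Z - r%:Z - k%:Z) * A p r k' + 4 * (p%:Z - 2 * r%:Z) * A p r.+1 k'
  end.

(* Main.v *)
Require Import Defs.
From mathcomp Require Import all_boot all_order all_algebra.
From mathcomp Require Import ring zify.

(** Solving the recurrence gives [A] as an explicit binomial sum ([A_closed]):
    counted by the number [i] of times the second summand is chosen, the
    products of the factors do not depend on the order of the choices, except
    that those coming from the first summand contribute [binom(k,i)] times the
    falling product [(p-r-i-1)...(p-r-k)].

    For [r = 0] and [p = 2n+1], [k = n], dividing the [i]-th term by
    [(p-1)...(p-n)] leaves
      [binom(n,i) 4^i p(p-2)...(p-2i+2) / ((p-1)...(p-i))].
    Pairing the odd factors [p(p-2)...] with the even factors [2n(2n-2)...]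
    hidden in [2^i binom(n,i)] turns this into [2^i p/(p-i) binom(p-i,i)]
    ([lucas_coef_ffact], [A_term]).  These are the terms of the Lucas polynomial
    [sum_i p/(p-i) binom(p-i,i) x^i] at [x = 2], whose value is [a^p + b^p] for
    the roots [a = 2], [b = -1] of [t^2 = t + 2].  For odd [p] this is [2^p - 1]
    ([sum_lucas_coef]), which is proved through the analogous Fibonacci
    polynomials ([sum_jacobsthal]). *)

Set Implicit Arguments.
Unset Strict Implicit.
Unset Printing Implicit Defensive.

Import GRing.Theory.
Local Open Scope ring_scope.

(** * The closed form of the recurrence *)

(** The binomial coefficient obeys Pascal's rule here because the step
    [(r, k) -> (r+1, k-1)] shifts both families of factors by exactly one
    index, so that both summands of the recurrence contribute the same
    products. *)
Lemma A_closed (p r k : nat) :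
  A p r k = \sum_(i < k.+1) 'C(k, i)%:Z * (4 ^+ i
     * \prod_(0 <= j < i) (p%:Z - 2 * (r + j)%:Z)
     * \prod_(i <= j < k) (p%:Z - (r + j.+1)%:Z)).
Proof.
elim: k r => [|k IHk] r; first by rewrite big_ord1 !big_geq //= bin0 !mulr1.
pose W i : int := 4 ^+ i * \prod_(0 <= j < i) (p%:Z - 2 * (r + j)%:Z)
     * \prod_(i <= j < k.+1) (p%:Z - (r + j.+1)%:Z).
rewrite -/(\sum_(i < k.+2) 'C(k.+1, i)%:Z * W i) /= !IHk.
have -> : \sum_(i < k.+2) 'C(k.+1, i)%:Z * W i =
    \sum_(i < k.+1) 'C(k, i)%:Z * W i + \sum_(i < k.+1) 'C(k, i)%:Z * W i.+1.
  have -> : \sum_(i < k.+1) 'C(k, i)%:Z * W i = \sum_(i < k.+2) 'C(k, i)%:Z * W i.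
    by rewrite [RHS]big_ord_recr /= bin_small // mul0r addr0.
  rewrite big_ord_recl [in RHS]big_ord_recl /= !bin0 -addrA -big_split /=.
  by congr (_ + _); apply: eq_bigr => i _; rewrite /bump /= add1n binS PoszD mulrDl.
rewrite !mulr_sumr; congr (_ + _); apply: eq_bigr => i _; rewrite /W.
  have le_ik : (i <= k)%N by rewrite -ltnS.
  by rewrite (big_nat_recr k) //= PoszD; ring.
have -> : \prod_(0 <= j < i.+1) (p%:Z - 2 * (r + j)%:Z) =
    (p%:Z - 2 * r%:Z) * \prod_(0 <= j < i) (p%:Z - 2 * (r.+1 + j)%:Z).
  by rewrite big_nat_recl // addn0; under eq_bigr do rewrite addnS -addSn.
have -> : \prod_(i.+1 <= j < k.+1) (p%:Z - (r + j.+1)%:Z) =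
    \prod_(i <= j < k) (p%:Z - (r.+1 + j.+1)%:Z).
  by rewrite big_add1; under eq_bigr do rewrite addnS -addSn.
by rewrite exprS; ring.
Qed.

(** * Coefficients of the Lucas polynomials *)

(** For [2i < p], this is [p/(p-i) binom(p-i,i)] in a form that is visibly an
    integer. *)
Definition lucas_coef (p i : nat) : nat :=
  ('C(p - i, i) + if i is j.+1 then 'C(p - 2 - j, j) else 0)%N.

Lemma mul_lucas_coef (p i : nat) : (i.*2 < p)%N ->
  ((p - i) * lucas_coef p i = p * 'C(p - i, i))%N.
Proof.
case: i => [|i] lt_ip; first by rewrite /lucas_coef subn0 addn0.
have -> : lucas_coef p i.+1 = ('C(p - i.+1, i.+1) + 'C((p - i.+1).-1, i))%N.
  by rewrite /lucas_coef; congr (_ + 'C(_, _))%N; lia.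
by rewrite mulnDr mul_bin_diag -mulnDl; congr (_ * _)%N; lia.
Qed.

Lemma ffact_addn (n i j : nat) : (n ^_ (i + j) = n ^_ i * (n - i) ^_ j)%N.
Proof.
elim: j => [|j IHj]; first by rewrite addn0 muln1.
by rewrite addnS !ffactnSr IHj subnDA mulnA.
Qed.

(** Dividing [p^_(2i) = p^_i (p-i)^_i] by [(p-1)^_i = p^_i (p-i)/p]. *)
Lemma lucas_coef_ffact (p i : nat) : (i.*2 < p)%N ->
  (lucas_coef p i * i`! * p.-1 ^_ i = p ^_ i.*2)%N.
Proof.
move=> lt_ip.
have pi_gt0 : (0 < p - i)%N by lia.
apply/eqP; rewrite -(eqn_pmul2l pi_gt0); apply/eqP.
rewrite -addnn ffact_addn -(bin_ffact (p - i)).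
have E : (p * p.-1 ^_ i = p ^_ i * (p - i))%N.
  by rewrite -ffactnS -ffactnSr.
transitivity (p * p.-1 ^_ i * 'C(p - i, i) * i`!)%N.
  by rewrite !mulnA mul_lucas_coef //; ring.
by rewrite E; ring.
Qed.

(** The even factors [2n, 2n-2, ...] of [(2n+1)^_(2i)] make up [2^i n^_i], and
    its odd factors are the product on the left. *)
Lemma ffact_odd_even (n i : nat) :
  (2 ^ i * n ^_ i * \prod_(0 <= j < i) (n.*2.+1 - j.*2) = n.*2.+1 ^_ i.*2)%N.
Proof.
elim: i => [|i IHi]; first by rewrite big_geq.
rewrite doubleS !ffactnSr -IHi big_nat_recr //= expnS.
have -> : (n.*2.+1 - i.*2.+1 = 2 * (n - i))%N by lia.
by ring.
Qed.

(** Multiplied by [i!], both sides become [(2n+1)^_(2i)]. *)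
Lemma bin_prod_lucas_coef (n i : nat) : (i <= n)%N ->
  ('C(n, i) * 2 ^ i * \prod_(0 <= j < i) (n.*2.+1 - j.*2)
     = n.*2 ^_ i * lucas_coef n.*2.+1 i)%N.
Proof.
move=> le_in; apply/eqP; rewrite -(eqn_pmul2r (fact_gt0 i)); apply/eqP.
transitivity (n.*2.+1 ^_ i.*2)%N.
  by rewrite -ffact_odd_even -(bin_ffact n); ring.
by rewrite -lucas_coef_ffact ?ltnS ?leq_double //=; ring.
Qed.

(** * Evaluating the Lucas polynomial at 2 *)

(** The sum satisfies [F(m+2) = F(m+1) + 2 F(m)] by Pascal's rule along the
    shallow diagonals, and 2 and -1 are the roots of [t^2 = t + 2].  The bound
    [N] is free because the terms with [m < 2i] vanish. *)
Lemma sum_jacobsthal (m N : nat) : (m < N.*2)%N ->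
  3 * \sum_(i < N) 2 ^+ i * 'C(m - i, i)%:Z = 2 ^+ m.+1 + (-1) ^+ m :> int.
Proof.
elim/ltn_ind: m N => -[|[|m]] IHm [|N] // lt_mN.
- by rewrite big_ord_recl big1 ?addr0 // => i _; rewrite sub0n mulr0.
- by rewrite big_ord_recl big1 ?addr0 // => i _; rewrite /= /bump /= subSS sub0n mulr0.
have IH1 := IHm m.+1 (ltnSn _) N.+1 (ltnW lt_mN).
have IH0 : 3 * \sum_(i < N) 2 ^+ i * 'C(m - i, i)%:Z = 2 ^+ m.+1 + (-1) ^+ m :> int.
  by apply: IHm => //; lia.
have -> : \sum_(i < N.+1) 2 ^+ i * 'C(m.+2 - i, i)%:Z =
    \sum_(i < N.+1) 2 ^+ i * 'C(m.+1 - i, i)%:Z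
      + 2 * \sum_(i < N) 2 ^+ i * 'C(m - i, i)%:Z :> int.
  rewrite !big_ord_recl /= !bin0 -addrA mulr_sumr -big_split /=; congr (_ + _).
  apply: eq_bigr => i _; rewrite /bump /= add1n !subSS.
  have -> : 'C(m.+1 - i, i.+1) = ('C(m - i, i.+1) + 'C(m - i, i))%N.
    have [le_im|lt_mi] := leqP i m; first by rewrite subSn // binS.
    by rewrite !bin_small //; lia.
  by rewrite PoszD exprS; ring.
by rewrite mulrDr IH1 mulrCA IH0 !exprS; ring.
Qed.

(** The two summands of [lucas_coef] give the identity
    [L(p) = F(p) + 2 F(p-2)] between the values at 2 of the Lucas and Fibonacci
    polynomials. *)
Lemma sum_lucas_coef (n : nat) :
  \sum_(i < n.+1) 2 ^+ i * (lucas_coef n.*2.+1 i)%:Z = 2 ^+ n.*2.+1 - 1 :> int.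
Proof.
(* For p = 1 the index p - 2 would be negative. *)
case: n => [|n]; first by rewrite big_ord1.
have -> : \sum_(i < n.+2) 2 ^+ i * (lucas_coef n.+1.*2.+1 i)%:Z =
    \sum_(i < n.+2) 2 ^+ i * 'C(n.+1.*2.+1 - i, i)%:Z
      + 2 * \sum_(i < n.+1) 2 ^+ i * 'C(n.*2.+1 - i, i)%:Z :> int.
  rewrite big_ord_recl [in RHS]big_ord_recl /= /lucas_coef addn0 -addrA.
  rewrite mulr_sumr -big_split /=; congr (_ + _).
  apply: eq_bigr => i _; rewrite /bump /= add1n PoszD mulrDr mulrA -exprS.
  by congr (_ + _ * Posz 'C(_, _)); lia.
apply: (@mulfI _ (3 : int)) => //.
rewrite mulrDr mulrCA !sum_jacobsthal ?ltn_double //; try lia.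
rewrite doubleS !exprS -[in LHS]signr_odd -[(-1) ^+ _]signr_odd odd_double.
by ring.
Qed.

(** * Reduction of the closed form to the Lucas polynomial *)

Lemma prod_ffactz (m i : nat) : (i <= m)%N ->
  \prod_(0 <= j < i) (m.+1%:Z - j.+1%:Z) = (m ^_ i)%:Z.
Proof.
elim: i => [|i IHi] lt_im; first by rewrite big_geq.
by rewrite big_nat_recr //= IHi ?(ltnW lt_im) // ffactnSr PoszM; congr (_ * _); lia.
Qed.

(** Only the first [i] factors of [(p-1)...(p-n)] are missing from the [i]-th
    term of [A_closed]; they form [(2n)^_i], which [bin_prod_lucas_coef]
    extracts from the rest of the term. *)
Lemma A_term (n i : nat) : (i <= n)%N ->
  'C(n, i)%:Z * (4 ^+ i
     * \prod_(0 <= j < i) (n.*2.+1%:Z - 2 * (0 + j)%:Z)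
     * \prod_(i <= j < n) (n.*2.+1%:Z - (0 + j.+1)%:Z))
  = 2 ^+ i * (lucas_coef n.*2.+1 i)%:Z
     * \prod_(0 <= j < n) (n.*2.+1%:Z - j.+1%:Z).
Proof.
move=> le_in.
have -> : \prod_(0 <= j < i) (n.*2.+1%:Z - 2 * (0 + j)%:Z) =
    (\prod_(0 <= j < i) (n.*2.+1 - j.*2)%N)%:Z.
  by rewrite (big_morph Posz PoszM (erefl _)); apply: eq_big_nat => j ?; lia.
rewrite (big_cat_nat (leq0n i) le_in) /= prod_ffactz; last by lia.
have -> : 4 ^+ i = 2 ^+ i * (2 ^ i)%N%:Z :> int.
  by rewrite -[(2 ^ i)%N%:Z]natz natrX -exprMn.
have := congr1 Posz (bin_prod_lucas_coef le_in); rewrite !PoszM => E.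
set Q := \prod_(i <= j < n) _.
transitivity (2 ^+ i * Q * ('C(n, i)%:Z * (2 ^ i)%N%:Z
    * (\prod_(0 <= j < i) (n.*2.+1 - j.*2)%N)%:Z)); first by ring.
by rewrite E; ring.
Qed.

Theorem theorem2 (p : nat) (p_odd : odd p) :
  2 ^+ p - 1 =
    (A p 0 (p %/ 2))%:~R / \prod_(1 <= j < (p %/ 2).+1) (p%:R - j%:R) :> rat.
Proof.
have [n ->] : exists n, p = n.*2.+1.
  by exists p./2; rewrite -[LHS]odd_double_half p_odd.
have -> : (n.*2.+1 %/ 2 = n)%N by lia.
have AE : A n.*2.+1 0 n =
    (2 ^+ n.*2.+1 - 1) * \prod_(0 <= j < n) (n.*2.+1%:Z - j.+1%:Z).
  rewrite A_closed -sum_lucas_coef mulr_suml.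
  by apply: eq_bigr => i _; rewrite A_term // -ltnS.
rewrite big_add1 /=.
have -> : \prod_(0 <= j < n) (n.*2.+1%:R - j.+1%:R) =
    (\prod_(0 <= j < n) (n.*2.+1%:Z - j.+1%:Z))%:~R :> rat.
  by rewrite rmorph_prod; apply: eq_bigr => j _; rewrite rmorphB.
rewrite AE rmorphM /= mulfK; first by rewrite rmorphB rmorphXn.
by rewrite prod_ffactz ?intr_eq0 -?lt0n ?ffact_gt0; lia.
Qed.
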